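(* Let $\mathbf F:\{-1,1\}^n\to\mathbb R^{\mathcal I\times\mathcal J}$ be a matrix-valued function whose entries $\mathbf F[I,J]$ are multilinear polynomials in $Z_1,\dots,Z_n$ of degree at most $d_p$, and let $Z$ be uniformly distributed on $\{-1,1\}^n$. Then for every integer $t\ge 1$, $$\mathbb E\,\big\|\mathbf F(Z)-\mathbb E\mathbf F\big\|_{2t}^{2t}\;\le\;\sum_{\substack{a,b\ge 0\\ 1\le a+b\le d_p}}(16\,t\,d_p)^{(a+b)t}\,\big\|\mathbb E\,\mathbf F_{a,b}\big\|_{2t}^{2t}.$$
   Context: $\mathcal I,\mathcal J$ are finite index sets. For $\alpha\in\{0,1\}^n$, $|\alpha|$ denotes the number of ones of $\alpha$, $\alpha\cdot\beta$ is the entrywise product, and $\nabla_\alpha=\prod_{i:\alpha_i=1}\frac{\partial}{\partial Z_i}$ (applied entrywise to matrices). $\mathbf F_{a,b}$ is the matrix with rows indexed by $\mathcal I\times\{0,1\}^n$ and columns by $\mathcal J\times\{0,1\}^n$ whose $[(I,\alpha),(J,\beta)]$ entry is $\nabla_{\alpha+\beta}\mathbf F[I,J]$ if $|\alpha|=a$, $|\beta|=b$ and $\alpha\cdot\beta=0$, and $0$ otherwise. For a real matrix $\mathbf M$, $\|\mathbf M\|_{2t}^{2t}=\operatorname{tr}\big((\mathbf M\mathbf M^\intercal)^t\big)$ (Schatten $2t$-norm to the power $2t$). *)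

(* Defs.v *)
From HB Require Import structures.
From mathcomp Require Import all_boot all_order all_algebra.
From mathcomp Require Import reals.
Set Implicit Arguments. Unset Strict Implicit. Unset Printing Implicit Defensive.
Import Order.TTheory GRing.Theory Num.Theory.
Local Open Scope ring_scope.

Section Defs.
Variable R : realType.
Variable n : nat.

(* A multilinear polynomial in Z_1..Z_n: the coefficient of the monomial
   prod_{i in S} Z_i, for every subset S of the variables. *)
Definition mlpoly := {ffun {set 'I_n} -> R}.

Definition ml_deg_le (p : mlpoly) (d : nat) : Prop :=
  forall S : {set 'I_n}, (d < #|S|)%N -> p S = 0.

Definition mleval (p : mlpoly) (z : 'I_n -> R) : R :=
  \sum_(S : {set 'I_n}) p S * \prod_(i in S) z i.

(* nabla_A p = (prod_{i in A} d/dZ_i) p, formal partial derivative: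
   Z^T |-> Z^(T \ A) if A \subset T, and 0 otherwise. *)
Definition mlderiv (A : {set 'I_n}) (p : mlpoly) : mlpoly :=
  [ffun S : {set 'I_n} => if [disjoint A & S] then p (A :|: S) else 0].

Definition sgnpt (b : {ffun 'I_n -> bool}) : 'I_n -> R :=
  fun i => if b i then 1 else -1.

Definition Eunif (f : ('I_n -> R) -> R) : R :=
  (2 ^+ n)^-1 * \sum_(b : {ffun 'I_n -> bool}) f (sgnpt b).

End Defs.

Definition tomx (R : realType) (I J : finType) (M : I -> J -> R)
  : 'M[R]_(#|I|, #|J|) := \matrix_(i, j) M (enum_val i) (enum_val j).

Definition schatten2t (R : realType) (I J : finType) (M : I -> J -> R) (t : nat) : R :=
  \tr ((tomx M *m (tomx M)^T) ^+ t).

(* E F_{a,b}: rows indexed by I x {0,1}^n, columns by J x {0,1}^n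
   (alpha in {0,1}^n encoded as the subset {i | alpha_i = 1}); entry
   E[nabla_{alpha+beta} F[I,J]] if |alpha| = a, |beta| = b, alpha.beta = 0,
   and 0 otherwise (when alpha.beta = 0, alpha+beta is the indicator of
   the union). *)
Definition EFab (R : realType) (n : nat) (I J : finType) (F : I -> J -> mlpoly R n)
  (a b : nat) : (I * {set 'I_n}) -> (J * {set 'I_n}) -> R :=
  fun r c =>
    if [&& #|r.2| == a, #|c.2| == b & [disjoint r.2 & c.2]] then
      Eunif (fun z => mleval (mlderiv (r.2 :|: c.2) (F r.1 c.1)) z)
    else 0.

(* Main.v *)
Require Import Defs.
From HB Require Import structures.
From mathcomp Require Import all_boot all_order all_algebra.
From mathcomp Require Import reals spectral complex sesquilinear.
From mathcomp Require Import ring lra zify.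
Import Order.TTheory GRing.Theory Num.Theory.
Local Open Scope ring_scope.

Set Implicit Arguments. Unset Strict Implicit. Unset Printing Implicit Defensive.

(** Split [F - E F] into its homogeneous parts.  If [X] is a symmetric matrix
    polynomial, homogeneous of degree [k > 0], then Euler's identity
    [k X = sum_i Z_i D_i X] and symmetrization over the flip of [Z_i] give
      [k E tr X^(2t) = sum_i sum_(l <= 2t-2) E tr (D_i X . X^l . D_i X . X'^(2t-2-l))]
    where [X'] is [X] with [Z_i] flipped; by convexity this is at most
    [(2t-1) E tr (V X^(2t-2))] with [V = sum_i (D_i X)^2], and Young's inequality
    turns it into [E tr X^(2t) <= (2t-1)^t E tr V^t].  Applied to the Hermitian
    dilation of [F_(a,b)], whose two diagonal blocks of [V] are multiples of the Gram
    matrices of [F_(a,b+1)] and [F_(a+1,b)], and iterated [k] times, it bounds the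
    degree-[k] part by the constants [E F_(a,b)] with [a + b = k].  The parts are put
    together with weights [2^(-k)] in the convexity of [tr X^(2t)]; these geometric
    weights only cost a factor [4^(kt)]. *)

(** * Algebraic identities for powers, and regrouping of double sums *)

Lemma trace_expZ (R : comNzRingType) N (a : R) (X : 'M[R]_N) k :
  \tr ((a *: X) ^+ k) = a ^+ k * \tr (X ^+ k).
Proof.
rewrite -mxtraceZ; congr mxtrace; elim: k => [|k IH]; first by rewrite !expr0 scale1r.
by rewrite !exprS IH -!mulmxE -scalemxAl -scalemxAr scalerA.
Qed.

(** Telescoping with the order of the factors kept, since a matrix polynomial need not commute with
    its flipped copy. *)
Lemma subrXX_noncomm (A : pzRingType) (x y : A) m :
  x ^+ m.+1 - y ^+ m.+1 = \sum_(k < m.+1) x ^+ k * (x - y) * y ^+ (m - k).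
Proof.
elim: m => [|m IH]; first by rewrite big_ord1 !expr0 mulr1 mul1r !expr1.
rewrite big_ord_recl expr0 mul1r subn0 /=.
rewrite (eq_bigr (fun k : 'I_m.+1 => x * (x ^+ k * (x - y) * y ^+ (m - k)))).
  rewrite -mulr_sumr -IH mulrBr mulrBl -!exprS.
  by rewrite [RHS]addrC addrA subrK.
by move=> k _; rewrite /= /bump /= add1n subSS exprS !mulrA.
Qed.

(** Sorts the pairs by their total degree [a + b]; it is written [k.+1] because degree zero is
    excluded. *)
Lemma sum_antidiagonals (V : nmodType) (f : nat -> nat -> V) d :
  \sum_(a < d.+1) \sum_(b < d.+1 | (1 <= a + b <= d)%N) f a b
  = \sum_(k < d) \sum_(a < k.+2) f a (k.+1 - a)%N.
Proof.
transitivity (\sum_(a < d.+1) \sum_(b < d.+1) \sum_(k < d | (a + b)%N == k.+1) f a b).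
  apply: eq_bigr => a _; rewrite big_mkcond; apply: eq_bigr => b _.
  case: ifPn => [/andP[ab0 abd]|abd].
    have kd : ((a + b).-1 < d)%N by rewrite prednK.
    rewrite (big_pred1 (Ordinal kd)) // => k.
    by rewrite /= -val_eqE /=; apply/eqP/eqP; lia.
  rewrite big1 // => k /eqP abk; case/negP: abd.
  by rewrite abk /= ltn_ord.
rewrite (eq_bigr _ (fun (a : 'I_d.+1) _ => exchange_big_dep predT _)) //= exchange_big /=.
apply: eq_bigr => k _; rewrite (big_ord_widen d.+1 (fun a => f a (k.+1 - a)%N)); last first.
  by rewrite ltnS ltn_ord.
rewrite [RHS]big_mkcond; apply: eq_bigr => a _; rewrite ltnS; case: ifPn => ak.
  have kd : (k.+1 - a < d.+1)%N by rewrite ltnS (leq_trans (leq_subr _ _)) ?ltn_ord.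
  rewrite (big_pred1 (Ordinal kd)) // => b.
  by rewrite /= -val_eqE /= -{1}(subnKC ak) eqn_add2l.
rewrite big1 // => b /eqP abk; case/negP: ak.
by rewrite -abk leq_addr.
Qed.

Lemma exp_conj_diag (A : comNzRingType) N (Q P : 'M[A]_N) (d : 'rV_N) k :
    P *m Q = 1%:M -> Q *m P = 1%:M ->
  (Q *m diag_mx d *m P) ^+ k = Q *m diag_mx (\row_i d 0 i ^+ k) *m P.
Proof.
move=> PQ QP; elim: k => [|k IH].
  rewrite expr0; set D := diag_mx _; have -> : D = 1%:M.
    by apply/matrixP => i j; rewrite !mxE expr0.
  by rewrite mulmx1 QP.
rewrite exprS IH -mulmxE !mulmxA -[_ *m P *m Q]mulmxA PQ mulmx1.
rewrite -[_ *m diag_mx d *m _]mulmxA mulmx_diag; congr (_ *m diag_mx _ *m _).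
by apply/rowP => i; rewrite !mxE exprS.
Qed.

(** * Spectral theorem for real symmetric matrices, through the complexification *)

Section SpectralMoments.
Local Open Scope sesquilinear_scope.

Lemma hermsymmx_exp_spectral (C : numClosedFieldType) N (A : 'M[C]_N) :
  A \is hermsymmx ->
  exists (P : 'M[C]_N) (d : 'rV[C]_N),
    [/\ P *m P^t* = 1%:M, forall i, d 0 i \is Num.real &
     forall k, A ^+ k = P^t* *m diag_mx (\row_i d 0 i ^+ k) *m P].
Proof.
move=> Ah; have /mxOverP dr := hermitian_spectral_diag_real Ah.
have /hermitian_normalmx/orthomx_spectralP := Ah.
have := spectral_unitarymx A; move: (spectralmx A) (spectral_diag A) dr.
move=> P d dr Pu AE.
have PP : P *m P^t* = 1%:M by apply/unitarymxP.
exists P; exists d; split=> // k.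
rewrite {1}AE invmx_unitary // exp_conj_diag //.
by rewrite -invmx_unitary // mulVmx // unitarymx_unit.
Qed.

(* [f] is the embedding of a real closed field into its complexification, kept
   abstract because conversion in the concrete [R[i]] is very slow. *)
Variables (R : rcfType) (C : numClosedFieldType) (f : {rmorphism R -> C}).
Hypothesis f_realP : forall z : C, reflect (exists x, z = f x) (z \is Num.real).
Hypothesis f_ge0 : forall x, (0 <= f x) = (0 <= x).

Lemma conj_map_real_mx M N (A : 'M[R]_(M, N)) : (map_mx f A)^t* = map_mx f A^T.
Proof.
apply/matrixP => i j; rewrite !mxE; apply/CrealP/f_realP.
by exists (A j i).
Qed.

Lemma symmx_exp_spectral N (X : 'M[R]_N) : X^T = X ->
  exists (P : 'M[C]_N) (d : 'I_N -> R),
    P *m P^t* = 1%:M /\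
    forall k, map_mx f (X ^+ k) = P^t* *m diag_mx (\row_i f (d i ^+ k)) *m P.
Proof.
move=> Xs; have Ah : map_mx f X \is hermsymmx.
  apply/is_hermitianmxP; rewrite expr0 scale1r.
  by rewrite map_trmx -map_trmx conj_map_real_mx Xs.
have [P [d [PP dr XE]]] := hermsymmx_exp_spectral Ah.
have /fin_all_exists[e eE] i : exists x, d 0 i = f x by apply/f_realP.
exists P; exists e; split=> // k.
have -> : map_mx f (X ^+ k) = map_mx f X ^+ k.
  elim: k => [|k IH]; first by rewrite !expr0 map_mx1.
  by rewrite !exprS -IH -!mulmxE map_mxM.
by rewrite XE; congr (_ *m diag_mx _ *m _); apply/rowP => i; rewrite !mxE eE rmorphXn.
Qed.

(** The weight [c i j] is the squared modulus of the entry of [G], which is [A] written in the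
    eigenbases of [X] and [Y]. When [X] is a sum of Gram matrices, each [x i] is a diagonal entry of
    [P X P^*], hence a sum of squared moduli. *)
Lemma joint_spectral_moments_over M N (X : 'M[R]_M) (Y : 'M[R]_N) (A : 'M[R]_(M, N)) :
  X^T = X -> Y^T = Y ->
  exists (x : 'I_M -> R) (y : 'I_N -> R) (c : 'I_M -> 'I_N -> R),
    [/\ forall i j, 0 <= c i j,
        forall (T : finType) (D : T -> 'M_M),
          X = \sum_s D s *m (D s)^T -> forall i, 0 <= x i
      & forall k l, \tr (A^T *m X ^+ k *m A *m Y ^+ l)
         = \sum_i \sum_j c i j * (x i ^+ k * y j ^+ l)].
Proof.
move=> /symmx_exp_spectral[P [x [PP XE]]] /symmx_exp_spectral[Q [y [QQ YE]]].
pose G := P *m map_mx f A *m Q^t*.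
have /fin_all_exists2[c c0 cE] (ij : 'I_M * 'I_N) :
    exists2 r, 0 <= r & f r = G ij.1 ij.2 * (G ij.1 ij.2)^*.
  have G0 := mul_conjC_ge0 (G ij.1 ij.2); have /f_realP[r rE] := ger0_real G0.
  by exists r; rewrite -?f_ge0 -rE.
exists x; exists y; exists (fun i j => c (i, j)); split=> //.
  move=> T D XD i; rewrite -f_ge0.
  have -> : f (x i) = (P *m map_mx f X *m P^t*) i i.
    rewrite -[X]expr1 XE !mulmxA PP mul1mx -mulmxA PP mulmx1 !mxE eqxx.
    by rewrite mulr1n expr1.
  rewrite XD map_mx_sum mulmx_sumr mulmx_suml summxE; apply: sumr_ge0 => s _.
  rewrite map_mxM -conj_map_real_mx mulmxA -mulmxA -map_mxM -trmx_mul.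
  by rewrite mxE; apply: sumr_ge0 => j _; rewrite !mxE mul_conjC_ge0.
move=> k l; apply: (fmorph_inj f).
have GE : Q *m map_mx f A^T *m P^t* = G^t*.
  by rewrite /G !(trmx_mul, map_mxM) trmxCK conj_map_real_mx mulmxA.
have -> : f (\tr (A^T *m X ^+ k *m A *m Y ^+ l)) =
    \tr (G^t* *m diag_mx (\row_i f (x i ^+ k)) *m G *m diag_mx (\row_i f (y i ^+ l))).
  rewrite -GE /G -trace_map_mx !map_mxM XE YE !mulmxA.
  by rewrite [LHS]mxtrace_mulC !mulmxA.
clearbody G; rewrite /mxtrace exchange_big rmorph_sum /=; apply: eq_bigr => j _.
rewrite mul_mx_diag mxE -[_ *m G]mulmxA mul_diag_mx !mxE mulr_suml rmorph_sum.
apply: eq_bigr => i _; rewrite !mxE !(rmorphM f) /= cE /=.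
by rewrite mulrCA mulrC [_^* * _]mulrC !mulrA; ring.
Qed.

End SpectralMoments.

(** * Trace inequalities for symmetric matrices, reduced to scalar ones *)

Section TraceInequalities.
Variable R : rcfType.

(* In the eigenbases of [X] and [Y] the mixed moments of [(X, Y)] through [A] are
   moments of one nonnegative measure on pairs of eigenvalues, which reduces
   trace inequalities to scalar ones. *)
Lemma joint_spectral_moments M N (X : 'M[R]_M) (Y : 'M[R]_N) (A : 'M[R]_(M, N)) :
  X^T = X -> Y^T = Y ->
  exists (x : 'I_M -> R) (y : 'I_N -> R) (c : 'I_M -> 'I_N -> R),
    [/\ forall i j, 0 <= c i j,
        forall (T : finType) (D : T -> 'M_M),
          X = \sum_s D s *m (D s)^T -> forall i, 0 <= x i
      & forall k l, \tr (A^T *m X ^+ k *m A *m Y ^+ l)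
         = \sum_i \sum_j c i j * (x i ^+ k * y j ^+ l)].
Proof.
exact: (joint_spectral_moments_over (f := real_complex R)
  (@complex_realP R) (@ler0c R)).
Qed.

(** Induction: multiply the inequality for [s] by [y] and add [(v - y)(v^(s+1) - y^(s+1)) >= 0],
    which holds because powers are monotone on nonnegative numbers. *)
Lemma scalar_young (s : nat) (v y : R) : 0 <= v -> 0 <= y ->
  s.+1%:R * (v * y ^+ s) <= v ^+ s.+1 + s%:R * y ^+ s.+1.
Proof.
move=> v0 y0; elim: s => [|s IH]; first by rewrite !expr1 expr0 mul0r; lra.
have H : 0 <= (v - y) * (v ^+ s.+1 - y ^+ s.+1).
  have [vy|/ltW yv] := leP v y.
    by rewrite mulr_le0 // subr_le0 // lerXn2r.
  by rewrite mulr_ge0 // subr_ge0 // lerXn2r.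
have {IH}H2 := ler_wpM2l y0 IH.
rewrite (exprS v s.+1) (exprS y s.+1) -[s.+2]addn1 natrD.
rewrite !exprS -[s.+1]addn1 natrD in H H2 *.
move: (v ^+ s) (y ^+ s) (s%:R) H H2 => a b c; nra.
Qed.

(** Adding the sum to its reversal pairs [x^k y^(m-k)] with [x^(m-k) y^k]. Each pair is at most
    [|x|^m + |y|^m], because [|x|^k - |y|^k] and [|x|^(m-k) - |y|^(m-k)] have the same sign; as [m]
    is even, the absolute values disappear at the end. *)
Lemma sum_mixed_powers_le (m : nat) (x y : R) : ~~ odd m ->
  \sum_(k < m.+1) x ^+ k * y ^+ (m - k) <= m.+1%:R / 2 * (x ^+ m + y ^+ m).
Proof.
move=> me; set S := \sum_(k < _) _.
have E : S = \sum_(k < m.+1) x ^+ (m - k) * y ^+ k.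
  rewrite /S (reindex_inj rev_ord_inj) /=; apply: eq_bigr => k _.
  by rewrite subSS subKn // -ltnS.
have xE (z : R) : z ^+ m = `|z| ^+ m.
  by rewrite -normrX [RHS]ger0_norm ?exprn_even_ge0.
suff : S + S <= \sum_(k < m.+1) (x ^+ m + y ^+ m).
  rewrite big_const_ord iter_addr_0 -mulr_natl; lra.
rewrite {2}E -big_split /=; apply: ler_sum => k _.
have km : (k <= m)%N by rewrite -ltnS.
have Hn (a b : R) i j : a ^+ i * b ^+ j <= `|a| ^+ i * `|b| ^+ j.
  by rewrite (le_trans (ler_norm _)) // normrM !normrX.
apply: (le_trans (lerD (Hn _ _ _ _) (Hn _ _ _ _))).
have mE (z : R) : z ^+ m = z ^+ k * z ^+ (m - k) by rewrite -exprD subnKC.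
rewrite (xE x) (xE y) !mE.
suff : 0 <= (`|x| ^+ k - `|y| ^+ k) * (`|x| ^+ (m - k) - `|y| ^+ (m - k)) by lra.
have [xy|/ltW yx] := leP `|x| `|y|.
  by rewrite mulr_le0 // subr_le0 lerXn2r ?nnegrE.
by rewrite mulr_ge0 // subr_ge0 lerXn2r ?nnegrE.
Qed.

(** Scalar Young at [r v] and [x^2], for eigenvalues [v] of [V] and [x] of [X]. Giving [V] as a sum
    of Gram matrices is what makes [v] nonnegative. The free factor [r] lets the constant of the
    derivative bound enter as [r^(s+1)]. *)
Lemma trace_young_psd N (X : 'M[R]_N) (T : finType) (D : T -> 'M[R]_N) (r : R) (s : nat)
    (V := \sum_i D i *m (D i)^T) : 0 <= r -> X^T = X ->
  s.+1%:R * (r * \tr (V *m X ^+ s.*2))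
    <= r ^+ s.+1 * \tr (V ^+ s.+1) + s%:R * \tr (X ^+ (s.+1).*2).
Proof.
move=> r0 Xs.
have Vs : V^T = V.
  by rewrite /V raddf_sum; apply: eq_bigr => i _; rewrite /= trmx_mul trmxK.
have [v [x [c [c0 v0 E]]]] := joint_spectral_moments 1%:M Vs Xs.
have F k l : \tr (V ^+ k *m X ^+ l) = \sum_i \sum_j c i j * (v i ^+ k * x j ^+ l).
  by rewrite -E trmx1 mul1mx mulmx1.
have -> : \tr (V ^+ s.+1) = \tr (V ^+ s.+1 *m X ^+ 0) by rewrite expr0 mulmx1.
have -> : \tr (X ^+ (s.+1).*2) = \tr (V ^+ 0 *m X ^+ (s.+1).*2).
  by rewrite expr0 mul1mx.
rewrite -{1}[V]expr1 !F !mulr_sumr -big_split /=; apply: ler_sum => i _.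
rewrite !mulr_sumr -big_split /=; apply: ler_sum => j _.
rewrite [r * _]mulrCA [_ * (c i j * (r * _))]mulrCA [r ^+ _ * _]mulrCA [s%:R * _]mulrCA -mulrDr.
apply: ler_wpM2l => //.
rewrite !expr0 mulr1 mul1r expr1 -!mul2n !exprM mulrA -exprMn.
by apply: scalar_young; [apply: mulr_ge0 => //; exact: (v0 T D) | exact: sqr_ge0].
Qed.

(** Here the eigenvalues may have any sign: scalar Young is applied to absolute values, and the even
    exponent [s.+1] forgets them. *)
Lemma trace_young_even N (A X : 'M[R]_N) (s : nat) : A^T = A -> X^T = X -> odd s ->
  s.+1%:R * \tr (A *m X ^+ s) <= \tr (A ^+ s.+1) + s%:R * \tr (X ^+ s.+1).
Proof.
move=> As Xs so.
have [v [x [c [c0 _ E]]]] := joint_spectral_moments 1%:M As Xs.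
have F k l : \tr (A ^+ k *m X ^+ l) = \sum_i \sum_j c i j * (v i ^+ k * x j ^+ l).
  by rewrite -E trmx1 mul1mx mulmx1.
have -> : \tr (A ^+ s.+1) = \tr (A ^+ s.+1 *m X ^+ 0) by rewrite expr0 mulmx1.
have -> : \tr (X ^+ s.+1) = \tr (A ^+ 0 *m X ^+ s.+1) by rewrite expr0 mul1mx.
rewrite -{1}[A]expr1 !F !mulr_sumr -big_split /=; apply: ler_sum => i _.
rewrite !mulr_sumr -big_split /=; apply: ler_sum => j _.
rewrite mulrCA [s%:R * _]mulrCA -mulrDr; apply: ler_wpM2l => //.
rewrite !expr0 mulr1 mul1r expr1.
have nE (z : R) : z ^+ s.+1 = `|z| ^+ s.+1.
  by rewrite -normrX [RHS]ger0_norm // exprn_even_ge0 //= so.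
rewrite (nE (v i)) (nE (x j)); apply: le_trans (scalar_young _ _ _) => //.
apply: ler_wpM2l => //.
by rewrite (le_trans (ler_norm _)) // normrM !normrX.
Qed.

Lemma trace_sum_mixed_powers_le M N (X : 'M[R]_M) (Y : 'M[R]_N) (A : 'M[R]_(M, N)) m :
  X^T = X -> Y^T = Y -> ~~ odd m ->
  \sum_(k < m.+1) \tr (A^T *m X ^+ k *m A *m Y ^+ (m - k))
    <= m.+1%:R / 2 * (\tr (A^T *m X ^+ m *m A) + \tr (A^T *m A *m Y ^+ m)).
Proof.
move=> Xs Ys me; have [x [y [c [c0 _ E]]]] := joint_spectral_moments A Xs Ys.
have -> : \tr (A^T *m X ^+ m *m A) = \tr (A^T *m X ^+ m *m A *m Y ^+ 0).
  by rewrite expr0 mulmx1.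
have -> : \tr (A^T *m A *m Y ^+ m) = \tr (A^T *m X ^+ 0 *m A *m Y ^+ m).
  by rewrite expr0 mulmx1.
rewrite (eq_bigr _ (fun (k : 'I_m.+1) _ => E k (m - k)%N)) !E -big_split /= exchange_big.
rewrite mulr_sumr; apply: ler_sum => i _.
rewrite -big_split exchange_big mulr_sumr /=; apply: ler_sum => j _.
rewrite -mulr_sumr -mulrDr mulrCA; apply: ler_wpM2l => //.
by rewrite !expr0 mulr1 mul1r; apply: sum_mixed_powers_le.
Qed.

(** Convexity obtained from Young: test [2A] and [2B] against [Z = A + B] and add. The left sides
    combine to [2(s+1) tr Z^(s+1)], of which [2s tr Z^(s+1)] is absorbed from the right. *)
Lemma trace_exp_add_le N (A B : 'M[R]_N) (s : nat) : A^T = A -> B^T = B -> odd s ->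
  \tr ((A + B) ^+ s.+1) <= 2 ^+ s * (\tr (A ^+ s.+1) + \tr (B ^+ s.+1)).
Proof.
move=> As Bs so.
have Zs : (A + B)^T = A + B by rewrite raddfD /= As Bs.
have tr2 C : C^T = C -> (2 *: C)^T = 2 *: C :> 'M[R]_N by rewrite linearZ /= => ->.
have HA := trace_young_even (tr2 _ As) Zs so.
have HB := trace_young_even (tr2 _ Bs) Zs so.
have E : \tr ((A + B) ^+ s.+1)
     = \tr (A *m (A + B) ^+ s) + \tr (B *m (A + B) ^+ s).
  by rewrite exprS -mulmxE mulmxDl raddfD.
rewrite -!scalemxAl !mxtraceZ !trace_expZ in HA HB.
rewrite E in HA HB *; rewrite -[s.+1]addn1 natrD addn1 !exprS in HA HB *.
move: HA HB; move: (2 ^+ s) (\tr _) (\tr _) (\tr _) (\tr _) (s%:R) => *; lra.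
Qed.

Lemma trace_even_exp_ge0 N (X : 'M[R]_N) s : X^T = X -> 0 <= \tr (X ^+ s.*2).
Proof.
move=> Xs; have -> : X ^+ s.*2 = X ^+ s *m (X ^+ s)^T.
  have -> : (X ^+ s)^T = X ^+ s.
    elim: s => [|s IH]; first by rewrite expr0 trmx1.
    by rewrite exprSr -mulmxE trmx_mul Xs IH mulmxE -exprS exprSr.
  by rewrite mulmxE -exprD addnn.
by apply: sumr_ge0 => i _; rewrite mxE; apply: sumr_ge0 => j _; rewrite mxE sqr_ge0.
Qed.

End TraceInequalities.

(** * Matrix polynomials on the sign cube: Walsh expansion, derivatives and flips *)

Section Cube.
Variables (R : realType) (n : nat).
Local Notation cube := {ffun 'I_n -> bool}.
Implicit Types (b : cube) (S : {set 'I_n}).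

Definition walsh S b : R := \prod_(i in S) sgnpt R b i.

Definition flip (i : 'I_n) b : cube := [ffun j => (j == i) (+) b j].

Lemma flipK i : involutive (flip i).
Proof. by move=> b; apply/ffunP => j; rewrite !ffunE addbA addbb. Qed.

Lemma sgnpt_sqr b i : sgnpt R b i * sgnpt R b i = 1.
Proof. by rewrite /sgnpt; case: ifP => _; rewrite ?mulrNN mulr1. Qed.

Lemma sgnpt_flip i b : sgnpt R (flip i b) i = - sgnpt R b i.
Proof. by rewrite /sgnpt ffunE eqxx /=; case: (b i); rewrite ?opprK. Qed.

Lemma walsh_flip_notin i S b : i \notin S -> walsh S (flip i b) = walsh S b.
Proof.
move=> iS; apply: eq_bigr => j jS; rewrite /sgnpt ffunE.
by case: eqP => // ji; rewrite -ji jS in iS.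
Qed.

Lemma walshU1 i S b : i \notin S -> walsh (i |: S) b = sgnpt R b i * walsh S b.
Proof. by move=> iS; rewrite /walsh big_setU1. Qed.

Lemma walsh_flip_in i S b : i \in S -> walsh S (flip i b) = - walsh S b.
Proof.
move=> iS; rewrite -(setD1K iS) !walshU1 ?setD11 // sgnpt_flip.
by rewrite walsh_flip_notin ?setD11 // mulNr.
Qed.

Section MatrixPolynomials.
Variables (p q : nat).
Implicit Types C : {set 'I_n} -> 'M[R]_(p, q).

Definition mxeval C b : 'M[R]_(p, q) := \sum_S walsh S b *: C S.

Definition mxderiv i C S : 'M[R]_(p, q) := if i \in S then 0 else C (i |: S).

(** Multiplying by [Z_i] restores the variable that differentiation removed: [S |-> i |: S] maps the
    sets avoiding [i] bijectively onto those containing it. *)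
Lemma mxeval_deriv C i b :
  sgnpt R b i *: mxeval (mxderiv i C) b = \sum_(S : {set 'I_n} | i \in S) walsh S b *: C S.
Proof.
rewrite scaler_sumr (bigID (fun S : {set 'I_n} => i \in S)) /= big1 ?add0r; last first.
  by move=> S iS; rewrite /mxderiv iS !scaler0.
rewrite [RHS](reindex_onto (fun S => i |: S) (fun S : {set 'I_n} => S :\ i)) /=; last first.
  by move=> S iS; rewrite setD1K.
apply: eq_big => [S|S iS]; last by rewrite scalerA /mxderiv (negbTE iS) walshU1.
rewrite setU11; case: (boolP (i \in S)) => iS; last by rewrite setU1K ?eqxx.
by apply/esym/negbTE; apply: contraL iS => /eqP <-; rewrite setD11.
Qed.

(** Only the monomials containing [i] change sign under the flip, so the difference is twice their
    sum. *)
Lemma mxeval_flip C i b :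
  mxeval C b - mxeval C (flip i b) = 2 * sgnpt R b i *: mxeval (mxderiv i C) b.
Proof.
rewrite -scalerA mxeval_deriv [in RHS]big_mkcond scaler_sumr -sumrB /=.
apply: eq_bigr => S _; case: ifPn => iS.
  by rewrite walsh_flip_in // scaleNr opprK -mulr2n scaler_nat.
by rewrite walsh_flip_notin // subrr scaler0.
Qed.

Lemma mxeval_deriv_flip C i b :
  mxeval (mxderiv i C) (flip i b) = mxeval (mxderiv i C) b.
Proof.
apply: eq_bigr => S _; rewrite /mxderiv; case: ifPn => iS; first by rewrite !scaler0.
by rewrite walsh_flip_notin.
Qed.

(** The monomial of [S] occurs in [Z_i D_i X] once for each [i] in [S], hence [k] times in all. *)
Lemma euler_homogeneous C k b : (forall S, #|S| != k -> C S = 0) ->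
  k%:R *: mxeval C b = \sum_i sgnpt R b i *: mxeval (mxderiv i C) b.
Proof.
move=> Ck; rewrite (eq_bigr _ (fun i _ => mxeval_deriv C i b)).
rewrite (exchange_big_dep predT) //= scaler_sumr; apply: eq_bigr => S _.
rewrite sumr_const; have [<-|/Ck ->] := eqVneq #|S| k; last by rewrite !scaler0 mul0rn.
by rewrite scaler_nat.
Qed.

End MatrixPolynomials.

Lemma tr_mxeval p q (C : {set 'I_n} -> 'M[R]_(p, q)) b :
  (mxeval C b)^T = mxeval (fun S => (C S)^T) b.
Proof. by rewrite raddf_sum; apply: eq_bigr => S _; rewrite /= linearZ. Qed.

Lemma tr_mxderiv p q (C : {set 'I_n} -> 'M[R]_(p, q)) i S :
  (mxderiv i C S)^T = mxderiv i (fun S => (C S)^T) S.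
Proof. by rewrite /mxderiv; case: ifP => // _; rewrite trmx0. Qed.

Lemma eq_mxeval p q (C C' : {set 'I_n} -> 'M[R]_(p, q)) b :
  C =1 C' -> mxeval C b = mxeval C' b.
Proof. by move=> CC'; apply: eq_bigr => S _; rewrite CC'. Qed.

Lemma mxeval_sym p (C : {set 'I_n} -> 'M[R]_p) b :
  (forall S, (C S)^T = C S) -> (mxeval C b)^T = mxeval C b.
Proof. by move=> Cs; rewrite tr_mxeval; apply: eq_mxeval. Qed.

Lemma mxderiv_sym p (C : {set 'I_n} -> 'M[R]_p) i :
  (forall S, (C S)^T = C S) -> forall S, (mxderiv i C S)^T = mxderiv i C S.
Proof. by move=> Cs S; rewrite /mxderiv; case: ifP => // _; rewrite trmx0. Qed.

(* Symmetrizing over the flip of the i-th sign turns [X ^+ m.+1] into the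
   noncommutative difference quotient of [x ^+ m.+1]. *)
Lemma sum_trace_deriv_le N (C : {set 'I_n} -> 'M[R]_N) m i :
    (forall S, (C S)^T = C S) -> ~~ odd m ->
  \sum_b sgnpt R b i * \tr (mxeval (mxderiv i C) b *m mxeval C b ^+ m.+1)
  <= m.+1%:R * \sum_b \tr (mxeval (mxderiv i C) b *m (mxeval (mxderiv i C) b)^T
                             *m mxeval C b ^+ m).
Proof.
move=> Cs me; set U := \sum_b \tr _; set T := \sum_b _.
pose X b := mxeval C b; pose D b := mxeval (mxderiv i C) b.
have Xs b : (X b)^T = X b by exact: mxeval_sym.
have Ds b : (D b)^T = D b by apply/mxeval_sym/mxderiv_sym.
have flipB : {on predT, bijective (flip i)} by apply/onW_bij/inv_bij/flipK.
have T' : T = - \sum_b sgnpt R b i * \tr (D b *m X (flip i b) ^+ m.+1).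
  rewrite /T (reindex (flip i)) // -sumrN; apply: eq_bigr => b _.
  by rewrite sgnpt_flip mxeval_deriv_flip mulNr.
(* Evaluated at the flipped point, [U] matches the second endpoint term of
   [trace_sum_mixed_powers_le], and in its original form the first. *)
have U' : U = \sum_b \tr ((D b)^T *m D b *m X (flip i b) ^+ m).
  rewrite /U (reindex (flip i)) //=; apply: eq_bigr => b _.
  by rewrite mxeval_deriv_flip -/(D b) Ds.
(* Adding the two forms of [T] leaves [X^(m+1) - X'^(m+1)]. Its telescoped middle factor is
   [2 Z_i D_i X], and the outer [Z_i] cancels the inner one because signs square to 1. *)
suff : T + T <= m.+1%:R * (U + U) by lra.
rewrite {2}T' {1}U' -sumrB -big_split mulr_sumr /=; apply: ler_sum => b _.
rewrite -/(X b) -/(D b) -mulrBr -raddfB -mulmxBr /= subrXX_noncomm mxeval_flip.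
rewrite mulmx_sumr raddf_sum mulr_sumr /=.
have H := trace_sum_mixed_powers_le (D b) (Xs b) (Xs (flip i b)) me.
have -> : \tr (D b *m (D b)^T *m X b ^+ m) = \tr ((D b)^T *m X b ^+ m *m D b).
  by rewrite Ds mxtrace_mulC mulmxA mxtrace_mulC !mulmxA.
rewrite (eq_bigr (fun k : 'I_m.+1 => 2 *
   \tr ((D b)^T *m X b ^+ k *m D b *m X (flip i b) ^+ (m - k)))); last first.
  move=> k _; rewrite -!mulmxE -scalemxAr -scalemxAl -scalemxAr mxtraceZ Ds.
  by rewrite !mulmxA mulrA mulrCA sgnpt_sqr mulr1.
rewrite -mulr_sumr; move: H; move: (\sum_(k < _) _) => Z; lra.
Qed.

Lemma sum_trace_homogeneous_le N (C : {set 'I_n} -> 'M[R]_N) k s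
    (V := fun b => \sum_i mxeval (mxderiv i C) b *m (mxeval (mxderiv i C) b)^T) :
    (forall S, (C S)^T = C S) -> (0 < k)%N -> (forall S, #|S| != k -> C S = 0) ->
  \sum_b \tr (mxeval C b ^+ s.+1.*2)
    <= s.*2.+1%:R ^+ s.+1 * \sum_b \tr (V b ^+ s.+1).
Proof.
move=> Cs k0 Ck; set T := \sum_b _.
have Xs b : (mxeval C b)^T = mxeval C b by exact: mxeval_sym.
have T0 : 0 <= T by apply: sumr_ge0 => b _; exact: trace_even_exp_ge0.
pose W := \sum_b \tr (V b *m mxeval C b ^+ s.*2).
(* Euler's identity bounds [k T]; only [k >= 1] and [T >= 0] are then used to drop the factor
   [k]. *)
have TW : T <= s.*2.+1%:R * W.
  have : k%:R * T <= s.*2.+1%:R * W.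
    rewrite mulr_sumr.
    have -> : \sum_b k%:R * \tr (mxeval C b ^+ s.+1.*2) = \sum_i \sum_b
        sgnpt R b i * \tr (mxeval (mxderiv i C) b *m mxeval C b ^+ s.*2.+1).
      rewrite exchange_big; apply: eq_bigr => b _ /=.
      rewrite doubleS exprS -mulmxE -mxtraceZ scalemxAl (euler_homogeneous _ Ck).
      rewrite mulmx_suml raddf_sum; apply: eq_bigr => i _ /=.
      by rewrite -scalemxAl mxtraceZ.
    have -> : W = \sum_i \sum_b \tr (mxeval (mxderiv i C) b
        *m (mxeval (mxderiv i C) b)^T *m mxeval C b ^+ s.*2).
      rewrite exchange_big; apply: eq_bigr => b _ /=.
      by rewrite mulmx_suml raddf_sum.
    rewrite mulr_sumr; apply: ler_sum => i _.
    by apply: sum_trace_deriv_le; rewrite ?odd_double.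
  by apply: le_trans; rewrite ler_peMl // ler1n.
(* Young with [r = 2s + 1]. After multiplying [TW] by [s + 1], the term [s T] cancels and a single
   [T] remains. *)
have : s.+1%:R * (s.*2.+1%:R * W)
    <= s.*2.+1%:R ^+ s.+1 * (\sum_b \tr (V b ^+ s.+1)) + s%:R * T.
  rewrite !mulr_sumr -big_split; apply: ler_sum => b _ /=.
  exact: trace_young_psd.
have := ler_wpM2l (ler0n R s.+1) TW.
have -> : s.+1%:R * T = s%:R * T + T by rewrite -natr1 mulrDl mul1r.
by move=> /le_trans h /h; rewrite addrC lerD2r.
Qed.

End Cube.

(** * Schatten moments of rectangular matrices and the Hermitian dilation *)

Section Gram.
Variable R : comNzRingType.
Variables p q : nat.
Implicit Types M : 'M[R]_(p, q).

Definition gram_trace p q (M : 'M[R]_(p, q)) t : R := \tr ((M *m M^T) ^+ t).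

Definition dilation M : 'M[R]_(p + q) := block_mx 0 M M^T 0.

Lemma exp_mulmx_shift M (N : 'M[R]_(q, p)) s :
  (M *m N) ^+ s.+1 = M *m (N *m M) ^+ s *m N.
Proof.
elim: s => [|s IH]; first by rewrite expr1 expr0 mulmx1.
by rewrite exprS IH -mulmxE [in RHS]exprS -mulmxE !mulmxA.
Qed.

(** Cyclicity of the trace. The exponent must be positive: at exponent 0 the two traces would be the
    dimensions [q] and [p]. *)
Lemma gram_trace_tr M s : gram_trace M^T s.+1 = gram_trace M s.+1.
Proof.
by rewrite /gram_trace trmxK [in RHS]exp_mulmx_shift mxtrace_mulC mulmxA mulmxE -exprS.
Qed.

Lemma exp_block_diag (A : 'M[R]_p) (B : 'M[R]_q) k :
  block_mx A 0 0 B ^+ k = block_mx (A ^+ k) 0 0 (B ^+ k).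
Proof.
elim: k => [|k IH]; first by rewrite !expr0 [LHS]scalar_mx_block.
rewrite exprS IH -mulmxE mulmx_block !mul0mx !mulmx0 !addr0 !add0r.
by rewrite !exprS.
Qed.

Lemma dilation_sqr M : dilation M *m dilation M = block_mx (M *m M^T) 0 0 (M^T *m M).
Proof. by rewrite mulmx_block !mul0mx !mulmx0 !addr0 !add0r. Qed.

Lemma trace_dilation M s :
  \tr (dilation M ^+ s.+1.*2) = 2 * gram_trace M s.+1.
Proof.
rewrite -mul2n exprM expr2 -mulmxE dilation_sqr exp_block_diag mxtrace_block.
by have := gram_trace_tr M s; rewrite /gram_trace trmxK => ->; rewrite mulrDl mul1r.
Qed.

Lemma dilation_sym M : (dilation M)^T = dilation M.
Proof. by rewrite tr_block_mx !trmx0 trmxK. Qed.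

Lemma dilationD : {morph dilation : M N / M + N}.
Proof. by move=> M N; rewrite /dilation add_block_mx !addr0 linearD. Qed.

Lemma dilation0 : dilation 0 = 0.
Proof. by apply/eqP; rewrite /dilation trmx0 block_mx_eq0 !eqxx. Qed.

Lemma dilationZ a M : dilation (a *: M) = a *: dilation M.
Proof. by rewrite /dilation scale_block_mx !scaler0 linearZ. Qed.

End Gram.

(** * Efron-Stein inequality for rectangular matrix polynomials *)

Section RectangularEfronStein.
Variables (R : realType) (n : nat).
Local Notation cube := {ffun 'I_n -> bool}.

Lemma gram_trace_ge0 p q (M : 'M[R]_(p, q)) s : 0 <= gram_trace M s.+1.
Proof.
have := trace_even_exp_ge0 s.+1 (dilation_sym M).
by rewrite trace_dilation pmulr_rge0.
Qed.

Lemma gram_trace_add p q (M N : 'M[R]_(p, q)) s :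
  gram_trace (M + N) s.+1 <= 2 ^+ s.*2.+1 * (gram_trace M s.+1 + gram_trace N s.+1).
Proof.
have := @trace_exp_add_le _ _ _ _ s.*2.+1 (dilation_sym M) (dilation_sym N).
rewrite -dilationD -!doubleS !trace_dilation /= odd_double => /(_ isT).
rewrite -mulrDr mulrCA ler_pM2l //; lra.
Qed.

Lemma mxeval_dilation p q (C : {set 'I_n} -> 'M[R]_(p, q)) (b : cube) :
  mxeval (fun S => dilation (C S)) b = dilation (mxeval C b).
Proof.
rewrite /mxeval (big_morph _ (@dilationD _ _ _) (@dilation0 _ _ _)).
by apply: eq_bigr => S _; rewrite dilationZ.
Qed.

Lemma mxderiv_dilation p q (C : {set 'I_n} -> 'M[R]_(p, q)) i (b : cube) :
  mxeval (mxderiv i (fun S => dilation (C S))) b = dilation (mxeval (mxderiv i C) b).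
Proof.
rewrite -mxeval_dilation; apply: eq_bigr => S _; congr (_ *: _).
by rewrite /mxderiv; case: ifP => // _; rewrite dilation0.
Qed.

(** The symmetric bound applied to the dilation. The squares of the dilated derivatives are block
    diagonal, so the row and column Gram sums separate; the factor 2 on the left comes from the two
    blocks of the dilated power. *)
Lemma gram_trace_efron_stein p q (C : {set 'I_n} -> 'M[R]_(p, q)) k s
    (D := fun i => mxeval (mxderiv i C)) :
    (0 < k)%N -> (forall S : {set 'I_n}, #|S| != k -> C S = 0) ->
  2 * (\sum_b gram_trace (mxeval C b) s.+1)
    <= s.*2.+1%:R ^+ s.+1 *
       (\sum_b (\tr ((\sum_i D i b *m (D i b)^T) ^+ s.+1)
              + \tr ((\sum_i (D i b)^T *m D i b) ^+ s.+1))).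
Proof.
move=> k0 Ck.
have := @sum_trace_homogeneous_le R n _ (fun S => dilation (C S)) k s
  (fun S => dilation_sym _) k0.
rewrite (eq_bigr (fun b : cube => 2 * gram_trace (mxeval C b) s.+1)); last first.
  by move=> b _; rewrite mxeval_dilation trace_dilation.
rewrite -mulr_sumr => H.
apply: (le_trans (H _)) => [S /Ck ->|]; first by rewrite dilation0.
rewrite le_eqVlt; apply/orP; left; apply/eqP; congr (_ * _).
apply: eq_bigr => b _.
rewrite (eq_bigr (fun i => block_mx (D i b *m (D i b)^T) 0 0 ((D i b)^T *m D i b))).
  rewrite (_ : \sum_i _ = block_mx (\sum_i D i b *m (D i b)^T) 0 0
      (\sum_i (D i b)^T *m D i b)); first by rewrite exp_block_diag mxtrace_block.
  elim/big_rec3: _ => [|i x y z _ ->]; last by rewrite add_block_mx !addr0.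
  by apply/esym/eqP; rewrite block_mx_eq0 !eqxx.
by move=> i _; rewrite mxderiv_dilation dilation_sym dilation_sqr.
Qed.

End RectangularEfronStein.

(** * Disjointness and cardinality of finite sets *)

Section DisjointSets.
Variable T : finType.
Implicit Types A B C : {set T}.

Lemma cardsU_disjoint A B : [disjoint A & B] -> #|A :|: B| = (#|A| + #|B|)%N.
Proof. by move=> AB; apply/eqP; rewrite (leq_card_setU A B). Qed.

Lemma disjointsU A B C : [disjoint A :|: B & C] = [disjoint A & C] && [disjoint B & C].
Proof. by rewrite !disjoints_subset subUset. Qed.

Lemma disjointsU1l x A B : [disjoint x |: A & B] = (x \notin B) && [disjoint A & B].
Proof. by rewrite disjointsU !disjoints_subset sub1set inE. Qed.

Lemma disjointsU1r x A B : [disjoint A & x |: B] = (x \notin A) && [disjoint A & B].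
Proof. by rewrite disjoint_sym disjointsU1l disjoint_sym. Qed.

End DisjointSets.

(** * Matrices indexed by finite types, and zero padding *)

Section Tomx.
Variable R : realType.
Implicit Types I J K : finType.

Lemma tr_tomx I J (M : I -> J -> R) : (tomx M)^T = tomx (fun j i => M i j).
Proof. by apply/matrixP => i j; rewrite !mxE. Qed.

Lemma eq_tomx I J (M N : I -> J -> R) : M =2 N -> tomx M = tomx N.
Proof. by move=> MN; apply/matrixP => i j; rewrite !mxE MN. Qed.

Lemma sum_enum_val I (f : I -> R) : \sum_(i < #|I|) f (enum_val i) = \sum_i f i.
Proof. by rewrite -big_enum_val; apply: eq_bigl. Qed.

Lemma tomx_mul I J K (M : I -> J -> R) (N : J -> K -> R) :
  tomx M *m tomx N = tomx (fun i k => \sum_j M i j * N j k).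
Proof.
apply/matrixP => i k; rewrite !mxE -[RHS]sum_enum_val.
by apply: eq_bigr => j _; rewrite !mxE.
Qed.

Lemma tomx_sum (T : finType) I J (M : T -> I -> J -> R) :
  \sum_t tomx (M t) = tomx (fun i j => \sum_t M t i j).
Proof. by apply/matrixP => i j; rewrite summxE mxE; apply: eq_bigr => t _; rewrite mxE. Qed.

Lemma tomxZ I J a (M : I -> J -> R) : a *: tomx M = tomx (fun i j => a * M i j).
Proof. by apply/matrixP => i j; rewrite !mxE. Qed.

Lemma gram_trace_isometry p q p' q' (M : 'M[R]_(p, q)) (E : 'M[R]_(p, p'))
    (E' : 'M[R]_(q, q')) s : E *m E^T = 1%:M -> E' *m E'^T = 1%:M ->
  gram_trace (E^T *m M *m E') s.+1 = gram_trace M s.+1.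
Proof.
move=> EE EE'; rewrite /gram_trace.
have -> : E^T *m M *m E' *m (E^T *m M *m E')^T = E^T *m (M *m M^T *m E).
  by rewrite !trmx_mul trmxK -!mulmxA [E' *m (E'^T *m _)]mulmxA EE' mul1mx.
have GE : M *m M^T *m E *m E^T = M *m M^T by rewrite -mulmxA EE mulmx1.
by rewrite [LHS](congr1 _ (exp_mulmx_shift _ _ _)) [LHS]mxtrace_mulC mulmxA GE mulmxE -exprS.
Qed.

(** Padding is compression by the isometric embeddings [k |-> (k, x0)]. It identifies [F_(0,0)],
    supported on the empty index sets, with [F]. *)
Lemma gram_trace_pad I J (T : finType) (x0 : T) (M : I -> J -> R) s :
  gram_trace (tomx (fun (r : I * T) (c : J * T) =>
     if (r.2 == x0) && (c.2 == x0) then M r.1 c.1 else 0)) s.+1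
  = gram_trace (tomx M) s.+1.
Proof.
pose E (K : finType) := tomx (fun (k : K) (r : K * T) => (r == (k, x0))%:R : R).
have EE K : E K *m (E K)^T = 1%:M.
  rewrite tr_tomx tomx_mul; apply/matrixP => i j; rewrite !mxE.
  rewrite (bigD1 (enum_val i, x0)) //= big1 => [|r /negbTE ->]; last by rewrite mul0r.
  rewrite eqxx mul1r addr0; congr (_%:R).
  by rewrite xpair_eqE eqxx andbT (inj_eq enum_val_inj).
rewrite -(gram_trace_isometry _ _ (EE I) (EE J)); congr gram_trace.
rewrite tr_tomx !tomx_mul; apply: eq_tomx => -[i t] [j u] /=.
case: eqP => [->|/eqP/negbTE tx] /=.
  case: eqP => [->|/eqP/negbTE ux].
    rewrite (bigD1 j) //= (bigD1 i) //= !eqxx mul1r mulr1 !big1 ?addr0 //.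
      by move=> k kj; rewrite xpair_eqE [j == k]eq_sym (negbTE kj) mulr0.
    by move=> k kj; rewrite xpair_eqE [i == k]eq_sym (negbTE kj) mul0r.
  by rewrite big1 // => k _; rewrite xpair_eqE ux andbF mulr0.
rewrite big1 // => k _; rewrite big1 ?mul0r // => l _.
by rewrite xpair_eqE tx andbF mul0r.
Qed.

End Tomx.

(** * The derivative matrices [F_(a,b)] as matrix polynomials *)

Section Derivatives.
Variables (R : realType) (n : nat).
Local Notation cube := {ffun 'I_n -> bool}.
Local Notation setn := {set 'I_n}.
Implicit Types (I J : finType) (S : setn).

(** Coefficient of the monomial of [S] in the polynomial matrix [F_(a,b)] before averaging, in the
    form that [mxeval] and [mxderiv] accept. *)
Definition Fab_coef (I J : finType) (F : I -> J -> mlpoly R n) a b (S : setn)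
    (r : I * setn) (c : J * setn) : R :=
  if [&& #|r.2| == a, #|c.2| == b, [disjoint r.2 & c.2] & [disjoint r.2 :|: c.2 & S]]
  then F r.1 c.1 (r.2 :|: c.2 :|: S) else 0.

Definition Fab_mx (I J : finType) (F : I -> J -> mlpoly R n) a b (S : setn) :=
  tomx (Fab_coef F a b S).

Lemma tr_Fab_mx (I J : finType) (F : I -> J -> mlpoly R n) a b S :
  (Fab_mx F a b S)^T = Fab_mx (fun j i => F i j) b a S.
Proof.
rewrite /Fab_mx tr_tomx; apply: eq_tomx => c r; rewrite /Fab_coef.
by rewrite setUC disjoint_sym andbCA.
Qed.

Lemma Fab_mx_homogeneous (I J : finType) (F : I -> J -> mlpoly R n) a b k :
  (forall i j (S : setn), #|S| != (a + b + k)%N -> F i j S = 0) ->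
  forall S : setn, #|S| != k -> Fab_mx F a b S = 0.
Proof.
move=> Fk S Sk; apply/matrixP => r c; rewrite !mxE /Fab_coef.
case: ifP => // /and4P[/eqP ra /eqP cb rc rcS]; apply: Fk.
by rewrite !cardsU_disjoint // ra cb eqn_add2l.
Qed.

(** One more derivative enlarges the column index by [i]. The test on [i] matters: if [i] already
    lies in [c.2], then [i |: c.2] is [c.2] itself, whose size may be [b.+1], whereas the derivative
    is zero. *)
Lemma mxderiv_Fab (I J : finType) (F : I -> J -> mlpoly R n) a b i (S : setn) :
  mxderiv i (Fab_mx F a b) S
  = tomx (fun r (c : J * setn) =>
      if i \in c.2 then 0 else Fab_coef F a b.+1 S r (c.1, i |: c.2)).
Proof.
rewrite /mxderiv; case: ifPn => iS; apply/matrixP => r' c'; rewrite !mxE;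
  move: (enum_val r') (enum_val c') => [x r] [y c] {r' c'}; rewrite /Fab_coef /=.
  case: ifP => // ic; case: ifP => // /and4P[_ _ _].
  by rewrite disjointsU disjointsU1l iS andbF.
have [ic|ic] := boolP (i \in c).
  case: ifP => // /and4P[_ _ _].
  by rewrite disjointsU1r inE ic orbT.
rewrite cardsU1 ic add1n eqSS.
have -> : r :|: (i |: c) :|: S = r :|: c :|: (i |: S).
  by rewrite [i |: c]setUC setUA -setUA.
have -> : [disjoint r :|: c & i |: S]
    = [&& i \notin r, [disjoint r & S] & [disjoint c & S]].
  by rewrite disjointsU1r inE (negbTE ic) orbF disjointsU.
have -> : [disjoint r & i |: c] = (i \notin r) && [disjoint r & c].
  exact: disjointsU1r.
have -> : [disjoint r :|: (i |: c) & S] = [disjoint r & S] && [disjoint c & S].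
  by rewrite disjointsU disjointsU1l iS.
by case: (i \in r); rewrite ?andbF.
Qed.

(* Adjoining the derivative index [i] to the column index [T] reaches every set of
   size [b.+1] in [b.+1] ways. *)
Lemma sum_deriv_gram (I J : finType) (F : I -> J -> mlpoly R n) a b (z : cube)
    (D := fun i => mxeval (mxderiv i (Fab_mx F a b)) z)
    (M := mxeval (Fab_mx F a b.+1) z) :
  \sum_i D i *m (D i)^T = b.+1%:R *: (M *m M^T).
Proof.
pose f r c := \sum_(S : setn) walsh R S z * Fab_coef F a b.+1 S r c.
have ME : M = tomx f.
  by rewrite /M /mxeval -tomx_sum; apply: eq_bigr => S _; rewrite tomxZ.
have DE i : D i = tomx (fun r (c : J * setn) => if i \in c.2 then 0 else f r (c.1, i |: c.2)).
  rewrite /D /mxeval; under eq_bigr => S _ do rewrite mxderiv_Fab tomxZ.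
  rewrite tomx_sum; apply: eq_tomx => r c; case: ifP => // _.
  by rewrite big1 // => S _; rewrite mulr0.
rewrite ME tr_tomx tomx_mul tomxZ.
under eq_bigr => i _ do rewrite DE tr_tomx tomx_mul.
rewrite tomx_sum; apply: eq_tomx => r r'.
rewrite -(pair_bigA _ (fun y (T : setn) => f r (y, T) * f r' (y, T))) mulr_sumr /=.
under eq_bigr => i _ do rewrite -(pair_bigA _ (fun y (T : setn) =>
  (if i \in T then 0 else f r (y, i |: T)) * (if i \in T then 0 else f r' (y, i |: T)))).
rewrite exchange_big; apply: eq_bigr => y _ /=.
rewrite (eq_bigr (fun i => \sum_(T : setn | i \in T) f r (y, T) * f r' (y, T))).
  rewrite (exchange_big_dep predT) //= mulr_sumr; apply: eq_bigr => T _.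
  rewrite sumr_const mulr_natl; have [->//|Tb] := eqVneq #|T| b.+1.
  have -> : f r (y, T) = 0.
    by rewrite /f big1 // => S _; rewrite /Fab_coef /= (negbTE Tb) andbF mulr0.
  by rewrite mul0r !mul0rn.
move=> i _; rewrite (bigID (fun T : setn => i \in T)) /= big1 ?add0r; last first.
  by move=> T ->; rewrite mul0r.
rewrite [RHS](reindex_onto (fun T : setn => i |: T) (fun T : setn => T :\ i)) /=; last first.
  by move=> T iT; rewrite setD1K.
apply: eq_big => [T|T /negbTE -> //].
rewrite setU11; case: (boolP (i \in T)) => iT; last by rewrite setU1K ?eqxx.
by apply/esym/negbTE; apply: contraL iT => /eqP <-; rewrite setD11.
Qed.

End Derivatives.

(** * Iterating the Efron-Stein step up to constant matrices, and recombining degrees *)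

Section Iteration.
Variables (R : realType) (n : nat).
Local Notation cube := {ffun 'I_n -> bool}.
Local Notation setn := {set 'I_n}.
Implicit Types (I J : finType) (S : setn).

Lemma tr_mxeval_Fab I J (F : I -> J -> mlpoly R n) a b (z : cube) :
  (mxeval (Fab_mx F a b) z)^T = mxeval (Fab_mx (fun j i => F i j) b a) z.
Proof. by rewrite tr_mxeval; apply: eq_mxeval => S; apply: tr_Fab_mx. Qed.

(** Transposition exchanges the roles of [a] and [b], reducing this to [sum_deriv_gram]. *)
Lemma sum_deriv_gram_tr I J (F : I -> J -> mlpoly R n) a b (z : cube)
    (D := fun i => mxeval (mxderiv i (Fab_mx F a b)) z)
    (M := mxeval (Fab_mx F a.+1 b) z) :
  \sum_i (D i)^T *m D i = a.+1%:R *: (M^T *m M).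
Proof.
have := sum_deriv_gram (fun j i => F i j) b a z.
cbv zeta; rewrite -tr_mxeval_Fab trmxK => <-; apply: eq_bigr => i _.
suff -> : mxeval (mxderiv i (Fab_mx (fun j i => F i j) b a)) z = (D i)^T by rewrite trmxK.
rewrite tr_mxeval; apply: eq_mxeval => S; rewrite tr_mxderiv /mxderiv.
by case: ifP => // _; rewrite tr_Fab_mx.
Qed.

(** A sum over the cube rather than a mean; the factor [2 ^+ n] is restored when the constant
    matrices are reached. *)
Definition Fab_moment I J (F : I -> J -> mlpoly R n) s a b : R :=
  \sum_(z : cube) gram_trace (mxeval (Fab_mx F a b) z) s.+1.

Lemma Fab_moment_ge0 I J (F : I -> J -> mlpoly R n) s a b : 0 <= Fab_moment F s a b.
Proof. by apply: sumr_ge0 => z _; apply: gram_trace_ge0. Qed.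

Lemma Fab_moment_step I J (F : I -> J -> mlpoly R n) s a b k :
  (forall i j S, #|S| != k -> F i j S = 0) -> (a + b < k)%N ->
  2 * Fab_moment F s a b <= s.*2.+1%:R ^+ s.+1 *
    (b.+1%:R ^+ s.+1 * Fab_moment F s a b.+1 + a.+1%:R ^+ s.+1 * Fab_moment F s a.+1 b).
Proof.
move=> Fk abk; have k0 : (0 < k - (a + b))%N by rewrite subn_gt0.
have := gram_trace_efron_stein s k0 (@Fab_mx_homogeneous _ _ _ _ F a b _ _).
rewrite subnKC 1?ltnW // => /(_ Fk) /le_trans; apply.
rewrite big_split !mulr_sumr -!big_split /=.
apply: ler_wpM2l; first by rewrite exprn_ge0.
apply: ler_sum => z _; rewrite sum_deriv_gram trace_expZ.
rewrite sum_deriv_gram_tr trace_expZ.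
by rewrite -(gram_trace_tr (mxeval (Fab_mx F a.+1 b) z)) /gram_trace trmxK.
Qed.

(** Each pair with [a + b = j + 1] is reached at most twice from those with sum [j], which the 2 in
    [Fab_moment_step] compensates. The multiplicities [a + 1] and [b + 1] never exceed [k], so every
    step costs at most [((2s+1)k)^(s+1)]. *)
Lemma Fab_moment_iter I J (F : I -> J -> mlpoly R n) s k j :
  (forall i j S, #|S| != k -> F i j S = 0) -> (j <= k)%N ->
  Fab_moment F s 0 0 <= ((s.*2.+1 * k)%:R ^+ s.+1) ^+ j
    * \sum_(a < j.+1) Fab_moment F s a (j - a)%N.
Proof.
move=> Fk; elim: j => [|j IH] jk; first by rewrite expr0 mul1r big_ord1.
apply: (le_trans (IH (ltnW jk))); rewrite [_ ^+ j.+1]exprSr -mulrA.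
apply: ler_wpM2l; first by rewrite !exprn_ge0.
set T := \sum_(a < j.+2) _; set c := _ ^+ s.+1.
have c0 : 0 <= c by rewrite exprn_ge0.
have M0 := Fab_moment_ge0 F s.
(* Raising [b] reaches every pair of the next antidiagonal but the last; raising [a], every pair but
   the first. The missing terms are nonnegative. *)
have T1 : \sum_(a < j.+1) Fab_moment F s a (j - a).+1%N <= T.
  rewrite /T [X in _ <= X]big_ord_recr /= subnn -[X in X <= _]addr0. apply: lerD => //.
  by apply: ler_sum => a _; rewrite subSn // -ltnS.
have T2 : \sum_(a < j.+1) Fab_moment F s a.+1 (j - a)%N <= T.
  rewrite /T [X in _ <= X]big_ord_recl /= -[X in X <= _]add0r; apply: lerD => //.
suff H (a : 'I_j.+1) : 2 * Fab_moment F s a (j - a)%N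
    <= c * (Fab_moment F s a (j - a).+1%N + Fab_moment F s a.+1 (j - a)%N).
  have : 2 * \sum_(a < j.+1) Fab_moment F s a (j - a)%N <= c * (T + T).
    rewrite mulr_sumr; apply: le_trans (ler_wpM2l c0 (lerD T1 T2)).
    by rewrite -big_split mulr_sumr; apply: ler_sum.
  by rewrite mulrDr -[leRHS](mulr_natl (c * T) 2) ler_pM2l.
have aj : (a <= j)%N by rewrite -ltnS.
have abk : (a + (j - a)%N < k)%N by rewrite subnKC.
apply: (le_trans (Fab_moment_step s Fk abk)).
rewrite /c natrM exprMn -mulrA; apply: ler_wpM2l; first by rewrite exprn_ge0.
rewrite mulrDr; apply: lerD; apply: ler_wpM2r => //; apply: lerXn2r;
  rewrite ?nnegrE // ler_nat; lia.
Qed.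

Lemma sum_walsh S : \sum_(z : cube) walsh R S z = if S == set0 then 2 ^+ n else 0.
Proof.
case: (set_0Vmem S) => [->|[i iS]].
  rewrite eqxx; under eq_bigr => z _ do rewrite /walsh big_set0.
  by rewrite sumr_const card_ffun card_bool card_ord natrX.
have -> : (S == set0) = false by apply/negbTE/set0Pn; exists i.
set T := \sum_z _; suff : T = - T by lra.
have flipB : {on predT, bijective (flip i)} by apply/onW_bij/inv_bij/flipK.
by rewrite {1}/T (reindex (flip i)) // -sumrN; apply: eq_bigr => z _; rewrite walsh_flip_in.
Qed.

Lemma Eunif_mleval (p : mlpoly R n) : Eunif (mleval p) = p set0.
Proof.
rewrite /Eunif /mleval exchange_big /=.
rewrite (eq_bigr (fun S => p S * if S == set0 then 2 ^+ n else 0)); last first.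
  by move=> S _; rewrite -mulr_sumr -sum_walsh.
rewrite (bigD1 set0) //= eqxx big1 ?addr0; last first.
  by move=> S /negbTE ->; rewrite mulr0.
by rewrite mulrC mulfK // expf_neq0 // pnatr_eq0.
Qed.

Lemma EFabE I J (F : I -> J -> mlpoly R n) a b : EFab F a b =2 Fab_coef F a b set0.
Proof.
have dis0 (A : setn) : [disjoint A & set0] by rewrite disjoint_sym disjoints_subset sub0set.
move=> r c; rewrite /EFab /Fab_coef dis0 andbT; case: ifP => // _.
by rewrite Eunif_mleval ffunE dis0.
Qed.

(** Once [a + b] is the full degree, [F_(a,b)] has degree zero and equals its expectation at every
    point. *)
Lemma Fab_moment_top I J (F : I -> J -> mlpoly R n) s a b :
  (forall i j S, #|S| != (a + b)%N -> F i j S = 0) ->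
  Fab_moment F s a b = 2 ^+ n * schatten2t (EFab F a b) s.+1.
Proof.
move=> Fk; rewrite /Fab_moment (eq_bigr (fun=> schatten2t (EFab F a b) s.+1)).
  by rewrite sumr_const card_ffun card_bool card_ord -[LHS]mulr_natl natrX.
move=> z _; rewrite /schatten2t -/(gram_trace _ _); congr gram_trace.
rewrite (eq_tomx (EFabE F a b)) -/(Fab_mx F a b set0) /mxeval (bigD1 set0) //=.
rewrite big1 ?addr0 => [|S S0]; first by rewrite /walsh big_set0 scale1r.
rewrite (@Fab_mx_homogeneous _ _ _ _ F a b 0) ?scaler0 ?cards_eq0 // => i j S'.
by rewrite addn0; apply: Fk.
Qed.

Lemma Fab_moment00 I J (F : I -> J -> mlpoly R n) s :
  Fab_moment F s 0 0 = \sum_(z : cube)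
    schatten2t (fun i j => mleval (F i j) (sgnpt R z)) s.+1.
Proof.
apply: eq_bigr => z _; rewrite /schatten2t -/(gram_trace _ _).
rewrite -(gram_trace_pad (T := setn) set0); congr gram_trace.
rewrite /mxeval; under eq_bigr => S _ do rewrite tomxZ.
rewrite tomx_sum; apply: eq_tomx => -[i A] [j B] /=; rewrite /Fab_coef /= !cards_eq0.
case: eqP => [->|_] /=; last by rewrite big1 // => S _; rewrite mulr0.
case: eqP => [->|_] /=; last by rewrite big1 // => S _; rewrite mulr0.
apply: eq_bigr => S _; rewrite !disjoints_subset setU0 !sub0set /= set0U mulrC.
by [].
Qed.

Lemma homogeneous_bound I J (F : I -> J -> mlpoly R n) s k :
  (forall i j S, #|S| != k -> F i j S = 0) ->
  \sum_(z : cube) schatten2t (fun i j => mleval (F i j) (sgnpt R z)) s.+1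
  <= 2 ^+ n * ((s.*2.+1 * k)%:R ^+ (k * s.+1)
      * \sum_(a < k.+1) schatten2t (EFab F a (k - a)%N) s.+1).
Proof.
move=> Fk; rewrite -Fab_moment00; apply: (le_trans (Fab_moment_iter s Fk (leqnn k))).
rewrite -exprM [(s.+1 * k)%N]mulnC [leRHS]mulrCA [2 ^+ n * _]mulr_sumr.
rewrite le_eqVlt; apply/orP; left; apply/eqP.
congr (_ * _); apply: eq_bigr => a _; apply: Fab_moment_top => i j S.
have ak : (a <= k)%N by rewrite -ltnS.
by rewrite subnKC //; apply: Fk.
Qed.

(** Terms are split off one at a time, each split costing [2^(2s+1)]; the term [Y k] has gone
    through [k + 1] splits. *)
Lemma gram_trace_sum p q (Y : nat -> 'M[R]_(p, q)) s m :
  gram_trace (\sum_(k < m) Y k) s.+1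
  <= \sum_(k < m) (2 ^+ s.*2.+1) ^+ k.+1 * gram_trace (Y k) s.+1.
Proof.
elim: m Y => [|m IH] Y.
  by rewrite !big_ord0 /gram_trace mul0mx expr0n /= raddf0.
rewrite !big_ord_recl /= expr1; apply: (le_trans (gram_trace_add _ _ _)).
rewrite mulrDr lerD2l; have := IH (fun k => Y k.+1).
move=> /(ler_wpM2l (exprn_ge0 s.*2.+1 (ler0n R 2))) /le_trans; apply.
by rewrite mulr_sumr; apply: ler_sum => k _; rewrite mulrA -exprS.
Qed.

Definition homog_part (p : mlpoly R n) k : mlpoly R n :=
  [ffun S : setn => if #|S| == k then p S else 0].

Lemma mleval_homog_sum (p : mlpoly R n) d z : ml_deg_le p d ->
  mleval p z - p set0 = \sum_(k < d) mleval (homog_part p k.+1) z.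
Proof.
move=> pd; rewrite /mleval exchange_big (bigD1 set0) //= big_set0 mulr1 addrAC subrr add0r.
rewrite [RHS](bigD1 set0) //= [X in _ = X + _]big1 ?add0r; last first.
  by move=> k _; rewrite ffunE cards0 mul0r.
apply: eq_bigr => S S0; have S1 : (0 < #|S|)%N by rewrite card_gt0.
rewrite -mulr_suml; congr (_ * _).
have [Sd|Sd] := leqP #|S| d; last first.
  rewrite pd // big1 // => k _; rewrite ffunE; case: eqP => // Sk.
  by have := ltn_ord k; lia.
have kd : (#|S|.-1 < d)%N by lia.
rewrite (bigD1 (Ordinal kd)) //= ffunE prednK // eqxx big1 ?addr0 // => k kS.
rewrite ffunE; case: eqP => // Sk; by case/eqP: kS; apply: val_inj; rewrite /= Sk.
Qed.

(** The expectation of an entry is the coefficient of the union of its index sets, which has exactly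
    [a + b] elements. *)
Lemma EFab_homog I J (F : I -> J -> mlpoly R n) a b :
  EFab (fun i j => homog_part (F i j) (a + b)%N) a b =2 EFab F a b.
Proof.
move=> r c; rewrite !EFabE /Fab_coef; case: ifP => // /and4P[/eqP ra /eqP cb rc _].
by rewrite setU0 ffunE cardsU_disjoint // ra cb eqxx.
Qed.

End Iteration.

(** * Summation over degrees and comparison of constants *)

Theorem mainTheorem1 (R : realType) (n : nat) (I J : finType)
  (F : I -> J -> mlpoly R n) (dp : nat)
  (hdeg : forall (i : I) (j : J), ml_deg_le (F i j) dp)
  (t : nat) (ht : (1 <= t)%N) :
  Eunif (fun z => schatten2t
           (fun (i : I) (j : J) =>
              mleval (F i j) z - Eunif (fun w => mleval (F i j) w)) t)
  <= \sum_(a < dp.+1) \sum_(b < dp.+1 | (1 <= a + b <= dp)%N)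
       ((16 * t * dp)%:R ^+ ((a + b) * t) * schatten2t (EFab F a b) t).
Proof.
case: t ht => // s _.
have P2 : 0 < 2 ^+ n :> R by rewrite exprn_gt0.
rewrite /Eunif ler_pdivrMl //.
pose Fk k i j := homog_part (F i j) k.
pose g a b := schatten2t (EFab F a b) s.+1.
pose f a b := (16 * s.+1 * dp)%:R ^+ ((a + b) * s.+1) * g a b.
have g0 a b : 0 <= g a b by exact: gram_trace_ge0.
have f0 a b : 0 <= f a b by rewrite mulr_ge0 ?exprn_ge0.
have -> : \sum_(a < dp.+1) \sum_(b < dp.+1 | (1 <= a + b <= dp)%N) f a b
    = \sum_(k < dp) \sum_(a < k.+2) f a (k.+1 - a)%N.
  exact: sum_antidiagonals.
rewrite mulr_sumr.
pose h k := \sum_(z : {ffun 'I_n -> bool})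
    schatten2t (fun i j => mleval (Fk k.+1 i j) (sgnpt R z)) s.+1.
apply: (@le_trans _ _ (\sum_(k < dp) (2 ^+ s.*2.+1) ^+ k.+1 * h k)).
  under [X in _ <= X]eq_bigr => k _ do rewrite /h mulr_sumr.
  rewrite [leRHS]exchange_big; apply: ler_sum => z _ /=.
  rewrite /schatten2t -/(gram_trace _ _).
  (* The mean is the constant coefficient, so the centred matrix is the sum of the parts of degrees
     1 to [dp]. *)
  have -> : tomx (fun i j => mleval (F i j) (sgnpt R z) - Eunif (mleval (F i j)))
     = \sum_(k < dp) tomx (fun i j => mleval (Fk k.+1 i j) (sgnpt R z)).
    rewrite tomx_sum; apply: eq_tomx => i j.
    by rewrite Eunif_mleval (mleval_homog_sum _ (hdeg i j)).
  exact: (gram_trace_sum (fun k => tomx (fun i j => mleval (Fk k.+1 i j) (sgnpt R z)))).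
apply: ler_sum => k _.
have Fkh i j (S : {set 'I_n}) : #|S| != k.+1 -> Fk k.+1 i j S = 0.
  by rewrite ffunE => /negbTE ->.
apply: (le_trans (ler_wpM2l _ (homogeneous_bound s Fkh))); first by rewrite !exprn_ge0.
rewrite mulrCA ler_pM2l // mulrA mulr_sumr; apply: ler_sum => a _.
have ak : (a <= k.+1)%N by rewrite -ltnS.
have -> : schatten2t (EFab (Fk k.+1) a (k.+1 - a)%N) s.+1 = g a (k.+1 - a)%N.
  rewrite /g /schatten2t; congr (\tr ((_ *m _^T) ^+ _)); apply: eq_tomx => r c;
    by rewrite -(EFab_homog F) subnKC.
rewrite /f subnKC //; apply: ler_wpM2r => //.
rewrite -exprM -natrX -[(_ * k.+1)%:R ^+ _]natrX -natrM -natrX ler_nat.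
(* The splitting cost [2^((2s+1)(k+1))] is at most [4^((k+1)(s+1))] and merges into the base. Then
   [4(2s+1)(k+1) <= 16(s+1)dp], because [k + 1 <= dp]. *)
apply: (@leq_trans ((4 * (s.*2.+1 * k.+1)) ^ (k.+1 * s.+1))%N).
  rewrite [leqRHS]expnMn leq_mul2r; apply/orP; right.
  by rewrite (_ : 4 = 2 ^ 2)%N // -expnM leq_exp2l //; nia.
by rewrite leq_exp2r ?muln_gt0 //; have := ltn_ord k; nia.
Qed.
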